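(* For every odd integer $d \ge 1$ there exists a function $\psi \in \Psi_d$ that does not admit a continuous derivative of order $[(d-1)/2]+1 = (d+1)/2$ on the open interval $(0,\pi)$.
   Context: For a real number $c$, $[c]$ denotes the greatest integer less than or equal to $c$. For an integer $d\ge 1$, $\mathbb{S}^d = \{x \in \mathbb{R}^{d+1} : \lVert x\rVert = 1\}$ with geodesic distance $\theta(u,v) = \arccos(\langle u,v\rangle) \in [0,\pi]$. A function $f:\mathbb{S}^d\times\mathbb{S}^d \to \mathbb{R}$ is positive definite if $\sum_{i=1}^n\sum_{j=1}^n c_i c_j f(u_i,u_j) \ge 0$ for all finite sets of points $u_1,\dots,u_n \in \mathbb{S}^d$ and all $c_1,\dots,c_n \in \mathbb{R}$. The class $\Psi_d$ consists of all continuous functions $\psi:[0,\pi]\to\mathbb{R}$ with $\psi(0)=1$ such that $(u,v)\mapsto\psi(\theta(u,v))$ is positive definite on $\mathbb{S}^d\times\mathbb{S}^d$. *)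

(* Defs.v *)
From HB Require Import structures.
From mathcomp Require Import all_boot all_order all_algebra.
From mathcomp Require Import all_classical all_reals all_analysis.

Set Implicit Arguments.
Unset Strict Implicit.
Unset Printing Implicit Defensive.

Import Order.TTheory GRing.Theory Num.Theory numFieldNormedType.Exports.

Local Open Scope classical_set_scope.
Local Open Scope ring_scope.

Definition inner (R : realType) (n : nat) (u v : 'rV[R]_n) : R :=
  \sum_(i < n) u 0 i * v 0 i.

(* Not the library's norm `|u| on row vectors, which is the sup norm. *)
Definition enorm (R : realType) (n : nat) (u : 'rV[R]_n) : R :=
  Num.sqrt (inner u u).

Definition sphere (R : realType) (d : nat) : set 'rV[R]_d.+1 :=
  [set u | enorm u = 1].

Definition geodesic_dist (R : realType) (n : nat) (u v : 'rV[R]_n) : R :=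
  acos (inner u v).

(* Only the values of f at pairs of points of S are constrained. *)
Definition positive_definite_on (R : realType) (T : Type) (S : set T)
    (f : T -> T -> R) : Prop :=
  forall (n : nat) (u : 'I_n -> T) (c : 'I_n -> R),
    (forall i, S (u i)) ->
    0 <= \sum_(i < n) \sum_(j < n) c i * c j * f (u i) (u j).

(* A function on [0, pi] is represented by a total function on R whose values
   outside [0, pi] are irrelevant; in particular, continuity is that of the
   restriction to [0, pi]. *)
Definition Psi (R : realType) (d : nat) : set (R -> R) :=
  [set psi : R -> R | [/\ {within `[0, pi], continuous psi},
                 psi 0 = 1 &
                 positive_definite_on (@sphere R d)
                   (fun u v => psi (geodesic_dist u v))]].

(* Meant for A open, so that the iterated derivatives at the points of A depend
   only on the restriction of f to A. As derive1n is total, the existence of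
   the derivatives of orders 1, ..., k is required separately. *)
Definition has_continuous_derivative_on (R : realType) (A : set R) (k : nat)
    (f : R -> R) : Prop :=
  (forall j : nat, (j < k)%N -> forall x, A x -> derivable (derive1n j f) x 1) /\
  (forall x, A x -> {for x, continuous (derive1n k f)}).

(* Main.v *)
From mathcomp Require Import all_boot all_order all_algebra.
From mathcomp Require Import ring lra zify.
From mathcomp Require ssrcomplements mpoly.

(** Write d = 2 l + 1. The positive definite function is a lacunary series
    psi(t) = sum_i a_i Q_{nu(i)}(t) with a_i > 0, where Q_n(t) is the l-th
    derivative of the Chebyshev polynomial T_n, evaluated at cos t and scaled to
    have the value 1 at t = 0. Up to a factor this derivative is the Gegenbauer
    polynomial of parameter l and degree n - l, so three facts are needed.

    Positive definiteness. The kernel Q_n(theta(u, v)) is positive definite on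
    the unit sphere of R^N, N = 2 l + 2. Homogenizing the polynomial in the
    variable x, with v a fixed unit vector, gives a polynomial Z_v on R^N; the
    Gegenbauer equation says exactly that Z_v is harmonic
    ([Fischer.zonal_harmonic]). In the Fischer inner product, multiplication by
    |x|^2 is adjoint to the Laplacian, so Z_u is orthogonal to all multiples of
    |x|^2, while pairing it with the power <v, x>^r amounts to evaluating it at
    v. As Z_v is a positive multiple of <v, x>^r modulo |x|^2, the Gram matrix
    of the Z_u is a positive multiple of the kernel ([Fischer.zonal_pd]).
    Applied to two points this also yields |Q_n| <= 1.

    Roughness. In the interior of (0, pi), Q_n oscillates like cos(n t - phase)
    with an amplitude of exact order n^(-l) ([cheb_deriv_asymptotics]). A
    difference of order l + 1 whose step is the half-period h = pi / n adds up
    values of alternating signs, and so has size at least a constant times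
    n^(-l), that is n h^(l+1) up to a constant ([gegenbauer_rough]). For a
    fixed trigonometric polynomial, and for any function with a continuous
    derivative of order l + 1, differences of that order on a compact
    subinterval are O(h^(l+1)) ([fdiff_horner_cos],
    [fdiff_continuous_derivative]).

    Gliding hump. The frequencies nu(i) are taken large enough for the i-th
    term to dominate the differences of the preceding ones at the step of the
    i-th frequency, and the following coefficients small enough for the tail to
    be harmless ([gliding_hump]). The differences of psi are then not
    O(h^(l+1)), so the derivative of order l + 1 = (d + 1) / 2 cannot exist and
    be continuous on (0, pi). *)

Set Implicit Arguments.
Unset Strict Implicit.
Unset Printing Implicit Defensive.

Import Order.TTheory GRing.Theory Num.Theory.

Local Open Scope ring_scope.

(** * Chebyshev polynomials and their derivatives *)

(** Coefficientwise form of the Gegenbauer equation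
    (1 - x^2) p'' - (2 l + 1) x p' + r (r + 2 l) p = 0,
    whose polynomial solutions of degree r are the multiples of the Gegenbauer
    polynomial of parameter l. *)
Definition gegenbauer_coefs (R : realFieldType) l r (p : {poly R}) : Prop :=
  (size p <= r.+1)%N /\
  forall j, (j.+2 * j.+1)%:R * p`_j.+2 =
            (j%:R - r%:R) * (j + r + 2 * l)%:R * p`_j.

Section Chebyshev.
Variable R : realFieldType.

(** The pairs (T_n, U_(n-1)): the recursion is the addition formula for
    cos((n + 1) t) and sin((n + 1) t) / sin t in the variable cos t. *)
Fixpoint chebTU n : {poly R} * {poly R} :=
  if n is n'.+1 then
    let: (t, u) := chebTU n' in ('X * t - (1 - 'X ^+ 2) * u, 'X * u + t)
  else (1, 0).
Definition chebT n := (chebTU n).1.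
Definition chebU n := (chebTU n).2.

Lemma chebTS n : chebT n.+1 = 'X * chebT n - (1 - 'X ^+ 2) * chebU n.
Proof. by rewrite /chebT /chebU /=; case: (chebTU n). Qed.

Lemma chebUS n : chebU n.+1 = 'X * chebU n + chebT n.
Proof. by rewrite /chebT /chebU /=; case: (chebTU n). Qed.

Lemma deriv_natr k : (k%:R : {poly R})^`() = 0.
Proof. by rewrite -polyC_natr derivC. Qed.

Lemma deriv_1subX2 : (1 - 'X ^+ 2 : {poly R})^`() = - (2%:R * 'X).
Proof. by rewrite derivB (deriv_natr 1) expr2 derivM derivX; ring. Qed.

(** The two identities support each other in the induction on n. In the
    variable cos t they are the derivatives of cos(n t) and sin(n t). *)
Lemma deriv_chebTU n : (chebT n)^`() = n%:R * chebU n /\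
  (1 - 'X ^+ 2) * (chebU n)^`() = 'X * chebU n - n%:R * chebT n.
Proof.
elim: n => [|n [IHT IHU]].
  by rewrite /chebT /chebU /= derivC deriv0 !mulr0 mul0r subr0.
have DT : (chebT n.+1)^`() = n.+1%:R * chebU n.+1.
  rewrite chebTS chebUS derivB !derivM deriv_1subX2 derivX IHU IHT.
  by rewrite -natr1; ring.
split=> //; rewrite {1}chebUS derivD derivM derivX mul1r !mulrDr mulrCA IHU IHT.
by rewrite chebUS chebTS -natr1; ring.
Qed.

(** The Chebyshev equation for k = 0, differentiated k times. *)
Lemma chebT_ode n k : (1 - 'X ^+ 2) * (chebT n)^`(k.+2) =
  (2 * k + 1)%:R * 'X * (chebT n)^`(k.+1)
  - (n%:R ^+ 2 - k%:R ^+ 2) * (chebT n)^`(k).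
Proof.
elim: k => [|k IHk].
  have [DT DU] := deriv_chebTU n.
  rewrite derivn1 derivn0 derivnS derivn1 DT derivM deriv_natr.
  by rewrite mul0r add0r mulrCA DU muln0; ring.
have /(congr1 (@deriv R)) := IHk.
rewrite derivB !derivM deriv_1subX2 derivB !expr2 !derivM !deriv_natr derivX.
rewrite -!derivnS => E.
rewrite -[LHS](addrK (- (2%:R * 'X) * (chebT n)^`(k.+2))) [_ + - _ * _]addrC E.
by rewrite !natrD !natrM -natr1; ring.
Qed.

(** The coefficient of U is only kept nonnegative, because it vanishes for
    n = 0; this is enough to carry the sign of the leading coefficient of T. *)
Lemma chebTU_coef n : [/\ (size (chebT n) <= n.+1)%N, (size (chebU n) <= n)%N,
  0 < (chebT n)`_n & 0 <= (chebU n)`_n.-1].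
Proof.
elim: n => [|n [sT sU pT pU]].
  by rewrite /chebT /chebU /= size_poly1 size_poly0 coef1 coef0.
have sXU : (size ('X * chebU n)%R <= n.+1)%N.
  by rewrite (leq_trans (size_polyMleq _ _)) // size_polyX.
have sXXU : (size ((1 - 'X^2) * chebU n)%R <= n.+2)%N.
  apply: leq_trans (size_polyMleq _ _) _.
  have : (size (1 - 'X^2 : {poly R})%R <= 3)%N.
    by rewrite (leq_trans (size_polyD _ _)) // size_polyN size_polyXn size_poly1.
  have aux x y : (x <= 3 -> y <= n -> (x + y).-1 <= n.+2)%N by lia.
  by move=> s3; apply: aux s3 sU.
have sXT : (size ('X * chebT n)%R <= n.+2)%N.
  by rewrite (leq_trans (size_polyMleq _ _)) // size_polyX.
split.
- by rewrite chebTS (leq_trans (size_polyD _ _)) // size_polyN geq_max sXT.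
- by rewrite chebUS (leq_trans (size_polyD _ _)) // geq_max sXU.
- rewrite chebTS mulrBl mul1r !(coefB, coefXM, coefXnM) /=.
  have -> : (chebU n)`_n.+1 = 0 by rewrite nth_default // ltnW.
  rewrite sub0r opprK; case: n pU {sT sU sXU sXXU sXT} pT => [|n] /= pU pT.
    by rewrite addr0.
  by rewrite subSS subn1 ltr_wpDr.
- rewrite chebUS coefD coefXM /=.
  by case: n pU {sT sU sXU sXXU sXT} pT => [|n] //= pU pT; rewrite ?add0r ?ltW // ltr_wpDl.
Qed.

(** At 1 the second-order term of the equation disappears, which leaves a
    recursion for the values of the derivatives. *)
Lemma chebT_derivn_at1 n k : (2 * k + 1)%:R * (chebT n)^`(k.+1).[1] =
  (n%:R ^+ 2 - k%:R ^+ 2) * (chebT n)^`(k).[1].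
Proof.
have /(congr1 (horner^~ 1)) := chebT_ode n k.
rewrite -!polyC_natr !hornerE expr1n subrr mul0r => /esym/eqP.
by rewrite subr_eq0 => /eqP.
Qed.


Lemma gegenbauer_chebT l r : gegenbauer_coefs l r (chebT (r + l))^`(l).
Proof.
have [sT _ _ _] := chebTU_coef (r + l).
split=> [|j].
  apply/leq_sizeP => j le_rj; rewrite coef_derivn nth_default ?mul0rn //.
  apply: leq_trans sT _; lia.
have /(congr1 (fun p : {poly R} => p`_j)) := chebT_ode (r + l) l.
rewrite !derivnS; move: ((chebT (r + l))^`(l)) => p.
(* Comparing coefficients of degree j, with degrees 0 and 1 apart since the
   factor 'X^2 contributes nothing there. *)
have -> : (r + l)%:R ^+ 2 - l%:R ^+ 2 = ((r%:R + l%:R) ^+ 2 - l%:R ^+ 2)%:P :> {poly R}.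
  by rewrite natrD polyCB !rmorphXn /= polyCD !polyC_natr.
rewrite mulrBl mul1r -polyC_natr -mulrA.
rewrite coefB coefXnM coefB !coefCM coefXM !coef_deriv.
have shift (x y z t : R) : z = t -> x = z - t + y -> x = y.
  by move=> -> ->; rewrite subrr add0r.
case: j => [|[|j]] /= /shift; apply; rewrite ?subSS ?subn0.
- by move: p`_0 p`_2 => x y; ring.
- by move: p`_1 p`_3 => x y; ring.
- by move: p`_j.+2 p`_j.+4 => x y; ring.
Qed.

Lemma gegenbauer_lead l r : 0 < ((chebT (r + l))^`(l))`_r.
Proof.
have [_ _ pT _] := chebTU_coef (r + l).
rewrite coef_derivn -mulr_natr mulr_gt0 //; first by rewrite (addnC l r).
by rewrite ltr0n ffact_gt0 leq_addr.
Qed.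
End Chebyshev.

(** * Positive definiteness through the Fischer inner product *)

Module Fischer.
Import ssrcomplements mpoly.

Section FischerForm.
Variables (R : realFieldType) (N : nat).
Implicit Types (p r : {mpoly R[N]}) (u v : 'I_N -> R).

Definition mfact (m : 'X_{1..N}) : nat := (\prod_(i < N) (m i)`!)%N.

(** The weights m! are those for which multiplication by a variable is adjoint to
    the derivative in it. *)
Definition fischer p r : R := \sum_(m <- msupp p) (mfact m)%:R * p@_m * r@_m.

Lemma fischerwE k p r : (msize p <= k)%N ->
  fischer p r = \sum_(m : 'X_{1..N < k}) (mfact m)%:R * p@_m * r@_m.
Proof.
move=> le_pk; rewrite /fischer; pose I : subFinType _ := 'X_{1..N < k}.
rewrite (big_mksub I) /= ?msupp_uniq //; last first.
  by move=> m /msize_mdeg_lt /leq_trans; apply.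
rewrite big_rmcond //= => m /memN_msupp_eq0 ->.
by rewrite mulr0 mul0r.
Qed.

Lemma fischerC p r : fischer p r = fischer r p.
Proof.
rewrite (@fischerwE (maxn (msize p) (msize r))) ?leq_maxl //.
rewrite (@fischerwE (maxn (msize p) (msize r)) r) ?leq_maxr //.
by apply: eq_bigr => m _; rewrite mulrAC.
Qed.

Lemma fischerDr p r1 r2 : fischer p (r1 + r2) = fischer p r1 + fischer p r2.
Proof.
by rewrite -big_split; apply: eq_bigr => m _; rewrite mcoeffD mulrDr.
Qed.

Lemma fischerZr a p r : fischer p (a *: r) = a * fischer p r.
Proof.
by rewrite mulr_sumr; apply: eq_bigr => m _; rewrite mcoeffZ mulrCA.
Qed.

Lemma fischer0r p : fischer p 0 = 0.
Proof. by apply: big1 => m _; rewrite mcoeff0 mulr0. Qed.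

Lemma fischer_sumr p (I : Type) (s : seq I) (P : pred I) F :
  fischer p (\sum_(i <- s | P i) F i) = \sum_(i <- s | P i) fischer p (F i).
Proof.
by apply: (big_morph (fischer p)); [apply: fischerDr | apply: fischer0r].
Qed.

Lemma fischerZl a p r : fischer (a *: p) r = a * fischer p r.
Proof. by rewrite fischerC fischerZr fischerC. Qed.

Lemma fischer_suml r (I : Type) (s : seq I) (P : pred I) F :
  fischer (\sum_(i <- s | P i) F i) r = \sum_(i <- s | P i) fischer (F i) r.
Proof. by rewrite fischerC fischer_sumr; under eq_bigr do rewrite fischerC. Qed.

Lemma fischer_ge0 p : 0 <= fischer p p.
Proof.
apply: sumr_ge0 => m _; rewrite -mulrA -expr2.
by rewrite mulr_ge0 ?ler0n ?sqr_ge0.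
Qed.

Lemma mfactDU (m : 'X_{1..N}) i : mfact (m + U_(i)) = ((m i).+1 * mfact m)%N.
Proof.
rewrite /mfact (bigD1 i) //= [in RHS](bigD1 i) //= mulnA.
rewrite mnmDE mnm1E eqxx addn1 factS; congr (_ * _)%N.
by apply: eq_bigr => j ji; rewrite mnmDE mnm1E eq_sym (negbTE ji) addn0.
Qed.

Lemma fischer_mulX p r i : fischer (p * 'X_i) r = fischer p r^`M(i).
Proof.
rewrite /fischer (perm_big _ (msuppMX p U_(i))) big_map.
apply: eq_bigr => m _; rewrite addmC mfactDU mcoeff_mderiv.
by rewrite addmC mcoeffMX -mulr_natl natrM; ring.
Qed.

Definition sqnorm : {mpoly R[N]} := \sum_(i < N) 'X_i ^+ 2.
Definition linform v : {mpoly R[N]} := \sum_(i < N) v i *: 'X_i.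
Definition laplacian p := \sum_(i < N) p^`M(i)^`M(i).
Definition dot u v : R := \sum_(i < N) u i * v i.

Lemma fischer_mul_sqnorm p r : fischer (sqnorm * p) r = fischer p (laplacian r).
Proof.
rewrite /sqnorm mulr_suml fischer_suml fischer_sumr; apply: eq_bigr => i _.
by rewrite mulrC expr2 mulrA !fischer_mulX.
Qed.

Lemma fischer_mul_linform v p r :
  fischer (linform v * p) r = fischer p (\sum_(i < N) v i *: r^`M(i)).
Proof.
rewrite /linform mulr_suml fischer_suml fischer_sumr; apply: eq_bigr => i _.
by rewrite -scalerAl fischerZl fischerZr ['X_i * p]mulrC fischer_mulX.
Qed.

Lemma mderiv_var i j : ('X_j : {mpoly R[N]})^`M(i) = (j == i)%:R.
Proof.
rewrite mderivX mnm1E; case: eqP => [->|_]; last by rewrite scale0r.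
by rewrite (_ : (U_(i) - U_(i))%MM = 0%MM) ?mpolyX0 ?scale1r //; apply/mnmP => k; rewrite mnmBE subnn mnm0E.
Qed.

Lemma mderiv_linform v i : (linform v)^`M(i) = (v i)%:MP.
Proof.
rewrite /linform raddf_sum (bigD1 i) //= mderivZ mderiv_var eqxx big1 => [|j ji].
  by rewrite addr0 alg_mpolyC.
by rewrite mderivZ mderiv_var (negbTE ji) scaler0.
Qed.

Lemma mderiv_sqnorm i : sqnorm^`M(i) = 2%:R * 'X_i.
Proof.
rewrite /sqnorm raddf_sum (bigD1 i) //= expr2 mderivM mderiv_var eqxx big1.
  by rewrite /= mulr1n; ring.
by move=> j ji; rewrite expr2 mderivM mderiv_var (negbTE ji) !(mul0r, mulr0) addr0.
Qed.

Lemma mderivXn i p k : (p ^+ k)^`M(i) = k%:R * p ^+ k.-1 * p^`M(i).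
Proof.
elim: k => [|k IHk]; first by rewrite expr0 -mpolyC1 mderivC !mul0r.
rewrite exprS mderivM IHk; case: k {IHk} => [|k] /=; first by rewrite !expr0; ring.
by rewrite exprS -natr1 -[k.+2%:R]natr1 -natr1; ring.
Qed.

(** The four kinds of second derivatives: both on the linear form, mixed, on
    |x|^2 through its constant Hessian, and on |x|^2 through its gradient. The
    last three all give a multiple of the same term. *)
Lemma laplacian_sqnorm_linform v s j : dot v v = 1 ->
  laplacian (sqnorm ^+ s * linform v ^+ j) =
    (j * j.-1)%:R * (sqnorm ^+ s * linform v ^+ j.-2) +
    (2 * s * (2 * s.-1 + N + 2 * j))%:R * (sqnorm ^+ s.-1 * linform v ^+ j).
Proof.
move=> v1; set q := sqnorm; set L := linform v.
have D1 i : (q ^+ s * L ^+ j)^`M(i) =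
   (2 * s)%:R * ('X_i * q ^+ s.-1 * L ^+ j) +
   j%:R * ((v i)%:MP * q ^+ s * L ^+ j.-1).
  rewrite mderivM !mderivXn mderiv_sqnorm mderiv_linform.
  by rewrite -/q -/L natrM; ring.
have D2 i : (q ^+ s * L ^+ j)^`M(i)^`M(i) =
    (2 * s)%:R * (q ^+ s.-1 * L ^+ j) +
    (2 * s)%:R * (2 * s.-1)%:R * q ^+ s.-2 * L ^+ j * 'X_i ^+ 2 +
    (4 * s * j)%:R * q ^+ s.-1 * L ^+ j.-1 * (v i *: 'X_i) +
    (j * j.-1)%:R * q ^+ s * L ^+ j.-2 * (v i * v i)%:MP.
  rewrite D1 mderivD -!mpolyC_nat !mderiv_mulC !mpolyC_nat.
  rewrite !mderivM mderivC mderiv_var eqxx !mderivXn mderiv_sqnorm mderiv_linform.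
  rewrite -/q -/L -mul_mpolyC mpolyCM !natrM /= ?mulr1n.
  move: (q ^+ s.-2) (q ^+ s.-1) (q ^+ s) (L ^+ j.-2) (L ^+ j.-1) (L ^+ j).
  move: 'X_i (v i)%:MP_[N] s.-1%:R s%:R j.-1%:R j%:R => x w s1 s0 j1 j0 a b c d e f.
  ring.
rewrite /laplacian (eq_bigr _ (fun i _ => D2 i)).
rewrite !big_split /= -!mulr_sumr -/q -/(linform v) -/L.
rewrite -rmorph_sum /= -/(dot v v) v1 sumr_const card_ord -[_ *+ N]mulr_natl.
rewrite rmorph1.
have E1 : (2 * s)%:R * (2 * s.-1)%:R * q ^+ s.-2 * L ^+ j * q =
          (2 * s)%:R * (2 * s.-1)%:R * q ^+ s.-1 * L ^+ j.
  clear D1 D2; case: s => [|[|s]] /=; [by ring | by ring |].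
  by rewrite [q ^+ s.+1]exprS; ring.
have E2 : (4 * s * j)%:R * q ^+ s.-1 * L ^+ j.-1 * L =
          (4 * s * j)%:R * q ^+ s.-1 * L ^+ j.
  clear D1 D2 E1; case: j => [|j] /=; first by rewrite muln0 !mul0r.
  by rewrite [L ^+ j.+1]exprS; ring.
rewrite E1 E2 !(natrM, natrD) mulr1; move: (N%:R) (s.-1%:R) (j.-1%:R) => N1 s1 j1.
move: (q ^+ s.-1) (q ^+ s) (L ^+ j.-2) (L ^+ j) => a b c d.
ring.
Qed.

Lemma fischer_linform_exp u v j : 
  fischer (linform v ^+ j) (linform u ^+ j) = j`!%:R * dot v u ^+ j.
Proof.
elim: j => [|j IHj].
  rewrite !expr0 mulr1 /fischer msupp1 big_seq1 !mcoeff1 eqxx !mulr1 /mfact.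
  by rewrite big1 // => i _; rewrite mnm0E.
rewrite exprS fischer_mul_linform.
under eq_bigr do rewrite mderivXn mderiv_linform mulrC mul_mpolyC scalerA.
rewrite -scaler_suml -/(dot v u) fischerZr /=.
rewrite -mpolyC_nat mul_mpolyC !fischerZr IHj factS natrM exprS; ring.
Qed.

(** Pairing with the n-th power of the linear form of u reproduces, up to n!,
    the value at u of a homogeneous polynomial of degree n; here the polynomial
    is |x|^(2 s) <v, x>^j and |u| = 1. *)
Lemma fischer_sqnorm_linform_exp u v s j : dot u u = 1 ->
  fischer (sqnorm ^+ s * linform v ^+ j) (linform u ^+ (2 * s + j)) =
    (2 * s + j)`!%:R * dot v u ^+ j.
Proof.
move=> u1; elim: s => [|s IHs]; first by rewrite mul1r fischer_linform_exp.
rewrite exprS -mulrA fischer_mul_sqnorm mulnS.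
have := laplacian_sqnorm_linform 0 (2 + 2 * s + j) u1; rewrite !mul1r => ->.
rewrite mul0r addr0 -mpolyC_nat mul_mpolyC fischerZr IHs !addSn add0n !factS /=.
by rewrite !natrM; ring.
Qed.

Lemma laplacian_sum I (s : seq I) (P : pred I) F :
  laplacian (\sum_(i <- s | P i) F i) = \sum_(i <- s | P i) laplacian (F i).
Proof.
apply: (big_morph laplacian) => [p r|]; rewrite /laplacian.
  by rewrite -big_split; apply: eq_bigr => i _; rewrite !mderivD.
by apply: big1 => i _; rewrite !mderiv0.
Qed.

Lemma laplacianZ a p : laplacian (a *: p) = a *: laplacian p.
Proof.
by rewrite /laplacian scaler_sumr; apply: eq_bigr => i _; rewrite !mderivZ.
Qed.

End FischerForm.

Section Gegenbauer.
Variable R : realFieldType.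
Implicit Types p : {poly R}.

(** Only the coefficients of the parity of r occur in p; they are read from the
    top degree r downwards, and cut off below degree 0. *)
Definition down_coef r p s : R := if (2 * s <= r)%N then p`_(r - 2 * s) else 0.

(** The coefficients of degree r - 1, r - 3, ... vanish: the equation relates
    each to the coefficient two degrees above, starting from degree r + 1,
    which lies beyond the size of p. *)
Lemma gegenbauer_parity l r p : gegenbauer_coefs l r p ->
  forall k, (k < r)%N -> ~~ odd k -> p`_(r - k.+1) = 0.
Proof.
move=> [szp rec_p] k; elim/ltn_ind: k => k IHk ltkr k_even.
have p2 : p`_(r - k.+1).+2 = 0.
  case: k IHk ltkr k_even => [|[|k]] // IHk ltkr k_even.
    by rewrite nth_default //; apply: leq_trans szp _; lia.
  have -> : (r - k.+3).+2 = (r - k.+1)%N by lia.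
  by apply: IHk; [|exact: ltn_trans ltkr|rewrite /= negbK in k_even].
have /eqP := rec_p (r - k.+1)%N; rewrite p2 mulr0 eq_sym mulf_eq0 => /orP[|/eqP //].
rewrite mulf_eq0 subr_eq0 eqr_nat pnatr_eq0 => H; exfalso.
by clear -ltkr H; lia.
Qed.

Lemma big_double (V : nmodType) n (G : nat -> V) :
  \sum_(i < 2 * n) G i = \sum_(s < n) (G (2 * s)%N + G (2 * s).+1).
Proof.
elim: n => [|n IHn]; first by rewrite !big_ord0.
by rewrite mulnS !big_ord_recr /= IHn addrA.
Qed.

Lemma gegenbauer_horner l r p x : gegenbauer_coefs l r p ->
  p.[x] = \sum_(s < r.+1) down_coef r p s * x ^+ (r - 2 * s).
Proof.
move=> gp; have [szp _] := gp; rewrite (horner_coef_wide _ szp).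
(* Reversed coefficients, padded by zeros up to an even number of terms. *)
pose G i := if (i <= r)%N then p`_(r - i) * x ^+ (r - i) else 0.
transitivity (\sum_(i < 2 * r.+1) G i).
  rewrite (reindex_inj rev_ord_inj) /= mul2n -addnn big_split_ord /=.
  rewrite [X in _ + X]big1 ?addr0 => [|i _]; last by rewrite /G leqNgt ltn_addr.
  by apply: eq_bigr => i _; rewrite /G subSS -ltnS ltn_ord.
rewrite big_double; apply: eq_bigr => s _; rewrite /G /down_coef.
case: ifP => [le_sr|_]; last rewrite mul0r.
  case: ifP => [lt_sr|]; last by rewrite addr0.
  by rewrite (gegenbauer_parity gp) ?mul0r ?addr0 // oddM.
by case: ifP => [lt_sr|]; rewrite ?addr0 // (gegenbauer_parity gp) ?mul0r ?addr0 // oddM.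
Qed.

Section Zonal.
Variables (l r : nat) (p : {poly R}).
Hypothesis gp : gegenbauer_coefs l r p.
Let N := (2 * l).+2.
Implicit Types u v : 'I_N -> R.

Lemma down_coef_rec s :
  ((r - 2 * s) * (r - 2 * s).-1)%:R * down_coef r p s +
  (2 * s.+1 * (2 * s + N + 2 * (r - 2 * s.+1)))%:R * down_coef r p s.+1 = 0.
Proof.
rewrite /down_coef; case: (leqP (2 * s.+1) r) => [le_sr|lt_rs]; last first.
  rewrite mulr0 addr0; case: ifP => _; last by rewrite mulr0.
  by rewrite (_ : (_ * _)%N = 0%N) ?mul0r //; nia.
rewrite ifT; last by lia.
have [k rk] : exists k, r = (2 * s.+1 + k)%N by exists (r - 2 * s.+1)%N; lia.
have [_ /(_ k)] := gp.
have -> : (r - 2 * s)%N = k.+2 by lia.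
have -> : (r - 2 * s.+1)%N = k by lia.
move=> /= ->; rewrite rk /N !(natrD, natrM, mulrS); ring.
Qed.

(** The homogenization of degree r of p(<u, x>), by powers of |x|^2. *)
Definition zonal u : {mpoly R[N]} :=
  \sum_(s < r.+1) down_coef r p s *: (sqnorm R N ^+ s * linform u ^+ (r - 2 * s)).

(** The Laplacian sends consecutive terms of the sum to multiples of a common
    polynomial, and the Gegenbauer equation makes the multiples cancel. The
    value N = 2 l + 2 of the dimension enters here. *)
Lemma zonal_harmonic u : dot u u = 1 -> laplacian (zonal u) = 0.
Proof.
move=> u1; rewrite /zonal laplacian_sum.
pose T s := sqnorm R N ^+ s * linform u ^+ (r - 2 * s.+1).
pose A s := ((r - 2 * s) * (r - 2 * s).-1)%:R * down_coef r p s.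
pose B s := (2 * s * (2 * s.-1 + N + 2 * (r - 2 * s)))%:R * down_coef r p s.
have E s : laplacian (down_coef r p s *:
    (sqnorm R N ^+ s * linform u ^+ (r - 2 * s))) =
    A s *: T s + (if s is s'.+1 then B s *: T s' else 0).
  rewrite laplacianZ laplacian_sqnorm_linform //.
  rewrite -!mpolyC_nat !mul_mpolyC scalerDr !scalerA /A /B /T.
  rewrite [_ * down_coef _ _ _]mulrC; congr (_ + _).
    by rewrite (_ : (r - 2 * s).-2 = (r - 2 * s.+1)%N) //; lia.
  by case: s => [|s] /=; rewrite ?muln0 ?mul0n ?mulr0 ?scale0r // mulrC.
under eq_bigr do rewrite E.
rewrite big_split /= big_ord_recr /=.
rewrite [X in _ + X]big_ord_recl /= add0r.
have -> : A r = 0.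
  rewrite /A /down_coef; case: ifP => [|_]; last by rewrite mulr0.
  by move=> h; rewrite (_ : (r - 2 * r)%N = 0%N) ?mul0n ?mul0r //; lia.
rewrite scale0r addr0 -big_split big1 //= => s _.
by rewrite -scalerDl /bump /= add1n /A /B down_coef_rec scale0r.
Qed.

Lemma fischer_zonal_exp u v : dot u u = 1 ->
  fischer (zonal v) (linform u ^+ r) = r`!%:R * p.[dot v u].
Proof.
move=> u1; rewrite /zonal fischer_suml (gegenbauer_horner _ gp) mulr_sumr.
apply: eq_bigr => s _; rewrite fischerZl /down_coef; case: ifP => [le_sr|_].
  have := fischer_sqnorm_linform_exp v s (r - 2 * s) u1.
  by rewrite subnKC // => ->; ring.
by rewrite !mul0r mulr0.
Qed.

(** For P = sum_i c_i Z_(u_i), write P = p_r sum_j c_j <u_j, x>^r + |x|^2 S.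
    As P is harmonic, it is orthogonal to |x|^2 S, so the square of its norm is
    p_r times its pairing with the powers, which is r! times the quadratic form
    of the kernel. *)
Lemma zonal_pd (p_gt0 : 0 < p`_r) n (u : 'I_n -> 'I_N -> R) (c : 'I_n -> R) :
  (forall i, dot (u i) (u i) = 1) ->
  0 <= \sum_(i < n) \sum_(j < n) c i * c j * p.[dot (u i) (u j)].
Proof.
move=> u1; pose P := \sum_(i < n) c i *: zonal (u i).
pose S := \sum_(i < n) c i *: \sum_(s < r)
  down_coef r p s.+1 *: (sqnorm R N ^+ s * linform (u i) ^+ (r - 2 * s.+1)).
have PE : P = p`_r *: \sum_(i < n) c i *: linform (u i) ^+ r + sqnorm R N * S.
  rewrite /P /S scaler_sumr mulr_sumr -big_split; apply: eq_bigr => i _ /=.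
  rewrite /zonal big_ord_recl /down_coef muln0 leq0n subn0 mul1r -scalerAr.
  rewrite scalerDr !scalerA mulrC; congr (_ + _ *: _).
  rewrite mulr_sumr; apply: eq_bigr => s _.
  by rewrite -scalerAr mulrA -exprS.
have := fischer_ge0 P.
rewrite {2}PE fischerDr [fischer P (_ * S)]fischerC fischer_mul_sqnorm.
have -> : laplacian P = 0.
  rewrite laplacian_sum big1 // => i _.
  by rewrite laplacianZ zonal_harmonic ?scaler0.
rewrite fischer0r addr0 fischerZr pmulr_rge0 // fischer_sumr.
under eq_bigr => j _.
  rewrite fischerZr /P fischer_suml.
  under eq_bigr => i _ do rewrite fischerZl fischer_zonal_exp //.
  over.
rewrite (_ : \sum_j _ = r`!%:R *
    \sum_(i < n) \sum_(j < n) c i * c j * p.[dot (u i) (u j)]).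
  by rewrite pmulr_rge0 // ltr0n fact_gt0.
rewrite [in RHS]exchange_big mulr_sumr; apply: eq_bigr => j _.
by rewrite !mulr_sumr; apply: eq_bigr => i _; ring.
Qed.
End Zonal.
End Gegenbauer.
End Fischer.

Require Import Defs.
From mathcomp Require Import all_boot all_order all_algebra.
From mathcomp Require Import all_classical all_reals all_analysis.

Import numFieldNormedType.Exports.

Local Open Scope classical_set_scope.
Local Open Scope ring_scope.

(** * Oscillation of the Gegenbauer polynomials *)

Section Asymptotics.
Variable R : realType.
Implicit Types t : R.

Lemma chebTU_cos n t : (chebT R n).[cos t] = cos (n%:R * t) /\
  (chebU R n).[cos t] * sin t = sin (n%:R * t).
Proof.
elim: n => [|n [IHT IHU]].
  by rewrite /chebT /chebU /= !hornerC mul0r cos0 sin0 mul0r.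
have -> : n.+1%:R * t = n%:R * t + t by rewrite -natr1 mulrDl mul1r.
rewrite chebTS chebUS cosD sinD -IHT -IHU -polyC1 !hornerE.
split; last by ring.
by rewrite -sin2cos2; ring.
Qed.

Definition cheb_deriv n j t : R := ((chebT R n)^`(j)).[cos t].

Lemma cheb_deriv_rec n j t : sin t ^+ 2 * cheb_deriv n j.+2 t =
  (2 * j + 1)%:R * cos t * cheb_deriv n j.+1 t
  - (n%:R ^+ 2 - j%:R ^+ 2) * cheb_deriv n j t.
Proof.
have /(congr1 (horner^~ (cos t))) := chebT_ode R n j.
by rewrite -!polyC_natr !hornerE sin2cos2.
Qed.

(** The j-th derivative of the cosine, up to the sign (-1)^j. *)
Definition phase j (x : R) : R := cos (x - j%:R * (pi / 2)).

Lemma phaseSS j x : phase j.+2 x = - phase j x.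
Proof.
rewrite /phase -cosDpi (_ : _ + pi = x - j.+2%:R * (pi / 2) + pi *+ 2).
  by rewrite cosD2pi.
by rewrite -[j.+2%:R]natr1 -natr1; field.
Qed.

(** The three-term recursion in j given by the Chebyshev equation is, up to
    lower powers of n, multiplication by - n^2, as for the phases. The condition
    |cos t| <= sin t bounds the term of order j + 1 without dividing by sin t,
    and keeps the constant uniform in t. *)
Lemma cheb_deriv_asymptotics j : exists2 C : R, 0 <= C & forall n t,
  (0 < n)%N -> 0 < sin t -> `|cos t| <= sin t ->
  n%:R * `|sin t ^+ j * cheb_deriv n j t - n%:R ^+ j * phase j (n%:R * t)|
    <= C * n%:R ^+ j.
Proof.
(* The recursion in j has two terms, so two consecutive orders are carried. *)
suff [] : (exists2 C : R, 0 <= C & forall n t,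
  (0 < n)%N -> 0 < sin t -> `|cos t| <= sin t ->
  n%:R * `|sin t ^+ j * cheb_deriv n j t - n%:R ^+ j * phase j (n%:R * t)|
    <= C * n%:R ^+ j) /\ (exists2 C : R, 0 <= C & forall n t,
  (0 < n)%N -> 0 < sin t -> `|cos t| <= sin t ->
  n%:R * `|sin t ^+ j.+1 * cheb_deriv n j.+1 t - n%:R ^+ j.+1 * phase j.+1 (n%:R * t)|
    <= C * n%:R ^+ j.+1) by [].
elim: j => [|j [[C C0 IH] [C' C'0 IH']]].
  split; exists 0 => // n t n0 s0 ct.
    rewrite /cheb_deriv derivn0 (chebTU_cos n t).1 /phase mul0r subr0.
    by rewrite !expr0 !mul1r subrr normr0 mulr0 mul0r.
  rewrite /cheb_deriv derivn1 (deriv_chebTU R n).1 -polyC_natr hornerM hornerC.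
  rewrite /phase mul1r cosBpihalf -(chebTU_cos n t).2.
  by rewrite !expr1 (_ : _ - _ = 0) ?normr0 ?mulr0 ?mul0r //; ring.
split; first by exists C'.
exists ((2 * j + 1)%:R * (1 + C') + C + j%:R ^+ 2 * (1 + C)).
  by rewrite !addr_ge0 ?mulr_ge0 ?addr_ge0 ?exprn_ge0 ?ler0n.
move=> n t n0 s0 ct; have {IH} := IH n t n0 s0 ct; have {IH'} := IH' n t n0 s0 ct.
rewrite phaseSS.
set w := phase j _; set w' := phase j.+1 _.
have w1 : `|w| <= 1 by rewrite ler_norml cos_geN1 cos_le1.
have w'1 : `|w'| <= 1 by rewrite ler_norml cos_geN1 cos_le1.
set z' := sin t ^+ j.+1 * _; set z := sin t ^+ j * _.
have n1 : 1 <= n%:R :> R by rewrite ler1n.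
have np k : 0 <= n%:R ^+ k :> R by rewrite exprn_ge0 ?ler0n.
move=> e' e.
have bound k a c : forall y v : R, `|v| <= 1 -> 
   n%:R * `|y - n%:R ^+ k * v| <= c * n%:R ^+ k -> a = y -> `|a| <= (1 + c) * n%:R ^+ k.
  move=> y v v1 h ->; rewrite -[y](subrK (n%:R ^+ k * v)) mulrDl mul1r.
  rewrite [leRHS]addrC (le_trans (ler_normD _ _)) // lerD //.
    by apply: le_trans h; rewrite ler_peMl.
  by rewrite normrM (ger0_norm (np k)) ler_piMr.
have bz : `|z| <= (1 + C) * n%:R ^+ j by exact: (bound _ _ _ _ _ w1 e).
have bz' : `|z'| <= (1 + C') * n%:R ^+ j.+1 by exact: (bound _ _ _ _ _ w'1 e').
have -> : sin t ^+ j.+2 * cheb_deriv n j.+2 t - n%:R ^+ j.+2 * - w =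
   (2 * j + 1)%:R * (cos t * sin t ^+ j * cheb_deriv n j.+1 t)
   - n%:R ^+ 2 * (z - n%:R ^+ j * w) + j%:R ^+ 2 * z.
  have -> : sin t ^+ j.+2 * cheb_deriv n j.+2 t =
     sin t ^+ j * (sin t ^+ 2 * cheb_deriv n j.+2 t) by rewrite !exprS; ring.
  by rewrite cheb_deriv_rec /z !exprS; ring.
have b1 : `|cos t * sin t ^+ j * cheb_deriv n j.+1 t| <= `|z'|.
  rewrite /z' exprS !normrM ler_wpM2r // ler_wpM2r //.
  by rewrite (le_trans ct) // ler_norm.
apply: le_trans (ler_wpM2l (ler0n _ n) (ler_normD _ _)) _.
rewrite mulrDr !mulrDl; apply: lerD.
  apply: le_trans (ler_wpM2l (ler0n _ n) (ler_normB _ _)) _.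
  rewrite mulrDr; apply: lerD.
    rewrite normrM normr_nat mulrCA -[leRHS]mulrA ler_wpM2l // [n%:R ^+ j.+2]exprS.
    by rewrite [(1 + C') * _]mulrCA ler_wpM2l // (le_trans b1).
  have -> : C * n%:R ^+ j.+2 = n%:R ^+ 2 * (C * n%:R ^+ j) by rewrite !exprS; ring.
  by rewrite normrM normrX normr_nat mulrCA ler_wpM2l.
rewrite normrM normrX normr_nat mulrCA -[leRHS]mulrA ler_wpM2l // [n%:R ^+ j.+2]exprS.
rewrite [(1 + C) * _]mulrCA ler_wpM2l // (le_trans bz) //.
by rewrite ler_wpM2l ?addr_ge0 // exprS ler_peMl.
Qed.
End Asymptotics.

Section Nodes.
Variable R : realType.
Implicit Types t : R.

(** The value at cos 0 = 1 is a product of l factors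
    (n^2 - k^2) / (2 k + 1), each between 0 and n^2. *)
Lemma cheb_deriv_at0 n l : (l < n)%N ->
  0 < cheb_deriv n l (0 : R) <= n%:R ^+ (2 * l).
Proof.
rewrite /cheb_deriv cos0; elim: l => [|l IHl] ltln.
  rewrite derivn0 -cos0 (chebTU_cos n 0).1 mulr0 cos0 muln0 expr0.
  by rewrite ltr01 lexx.
have /andP[y0 yn] := IHl (ltnW ltln).
have := chebT_derivn_at1 R n l; set y' := _.[1]; set y := _.[1] in y0 yn *.
have a1 : 1 <= (2 * l + 1)%:R :> R by rewrite ler1n addn1.
have b0 : 0 < n%:R ^+ 2 - l%:R ^+ 2 :> R.
  by rewrite subr_gt0 ltr_pXn2r ?nnegrE ?ler0n // ltr_nat ltnW.
have bn : n%:R ^+ 2 - l%:R ^+ 2 <= n%:R ^+ 2 :> R by rewrite gerBl sqr_ge0.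
move: b0 bn; set b := _ - _ => b0 bn E.
have y'0 : 0 < y'.
  by rewrite -(pmulr_rgt0 _ (lt_le_trans ltr01 a1)) E mulr_gt0.
rewrite y'0 /=; apply: (@le_trans _ _ (b * y)); first by rewrite -E ler_peMl // ltW.
by rewrite mulnS exprD ler_pM // ltW.
Qed.

Definition gegenbauer l n t := cheb_deriv n l t / cheb_deriv n l 0.

(** Even frequencies, so that pi / 2 is a multiple of the half-period
    mesh = pi / freq; the shift by l / 2 mesh puts the sequence of nodes that
    begins at start on the extrema of the phase of order l. The lower bound on
    freq keeps l + 2 consecutive nodes below 3 pi / 4. *)
Definition freq l k := (2 * (k + 3 * l + 2))%N.
Definition mesh l k : R := pi / (freq l k)%:R.
Definition start l k : R := pi / 2 + l%:R / 2 * mesh l k.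

Lemma freq_gt0 l k : 0 < (freq l k)%:R :> R.
Proof. by rewrite ltr0n /freq; lia. Qed.

Lemma mesh_gt0 l k : 0 < mesh l k.
Proof. by rewrite divr_gt0 ?pi_gt0 ?freq_gt0. Qed.

Lemma node_range l k i : (i <= l.+1)%N ->
  pi / 2 <= start l k + i%:R * mesh l k <= pi * (3 / 4).
Proof.
move=> le_il; have m0 := mesh_gt0 l k.
rewrite /start -addrA -mulrDl; set c : R := l%:R / 2 + i%:R.
have c0 : 0 <= c by apply: addr_ge0; rewrite ?divr_ge0 ?ler0n.
rewrite lerDl mulr_ge0 ?(ltW m0) //=.
have -> : pi * (3 / 4) = pi / 2 + pi / 4 :> R by field.
rewrite lerD2l /mesh mulrCA ler_pM2l ?pi_gt0 // ler_pdivrMr ?freq_gt0 //.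
rewrite /c -(@ler_pM2l _ 4) // mulVKf //.
have -> : 4 * (l%:R / 2 + i%:R) = (2 * l + 4 * i)%:R :> R.
  by rewrite natrD !natrM; field.
by rewrite ler_nat /freq; lia.
Qed.

Lemma node_trig t : pi / 2 <= t <= pi * (3 / 4) -> 0 < sin t /\ `|cos t| <= sin t.
Proof.
have p0 := pi_gt0 R.
move=> /andP[t1 t2]; set a := t - pi / 2.
have a0 : 0 <= a by rewrite subr_ge0.
have a1 : a *+ 2 <= pi / 2 by rewrite /a -mulr_natl; lra.
have -> : t = a + pi / 2 by rewrite subrK.
rewrite sinDpihalf cosDpihalf normrN.
have ca : 0 < cos a by apply: cos_gt0_pihalf; rewrite /a; lra.
have sa : 0 <= sin a.
  by apply: sin_ge0_pi; apply/andP; split => //; rewrite /a; lra.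
split=> //; rewrite ger0_norm //.
rewrite -ler_sqr ?nnegrE ?(ltW ca) // sin2cos2.
have : 0 <= cos (a *+ 2).
  apply: cos_ge0_pihalf; rewrite a1 andbT.
  by apply: (@le_trans _ _ 0); [lra | rewrite mulrn_wge0].
by rewrite cos_mulr2n -mulr_natl; lra.
Qed.

Lemma cos_nat_pi n : cos (n%:R * pi) = (-1) ^+ n :> R.
Proof.
elim: n => [|n IHn]; first by rewrite mul0r cos0.
by rewrite -natr1 mulrDl mul1r cosDpi IHn exprS mulN1r.
Qed.

Lemma phase_node l k i :
  phase l ((freq l k)%:R * (start l k + i%:R * mesh l k)) =
  (-1) ^+ (k + 3 * l + 2 + i) :> R.
Proof.
rewrite /phase -cos_nat_pi; congr cos.
have : (k + 3 * l + 2)%:R != 0 :> R by rewrite pnatr_eq0; lia.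
rewrite /start /mesh /freq natrM [in RHS]natrD; move: (k + 3 * l + 2)%:R => w w0.
by field.
Qed.

(** At the nodes the leading term of the asymptotics has modulus exactly n^l and
    alternating signs; for large n the error is at most half of it, and the
    normalizing value at 0 is at most n^(2 l). *)
Lemma gegenbauer_node l : exists K, forall k i, (K <= k)%N -> (i <= l.+1)%N ->
  (freq l k)%:R ^- l / 2 <=
  (-1) ^+ (k + 3 * l + 2 + i) * gegenbauer l (freq l k) (start l k + i%:R * mesh l k).
Proof.
have [C C0 HC] := cheb_deriv_asymptotics R l.
exists (Num.truncn C).+1 => k i leKk le_il.
have [s0 cs] := node_trig (node_range k le_il).
have n0 := freq_gt0 l k.
have {HC} := HC (freq l k) _ _ s0 cs; rewrite phase_node.
set t := start l k + _ in s0 cs *; set n := freq l k in n0 *.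
set e := (-1) ^+ _ => /(_ (ltac:(by rewrite -(ltr0n R)))).
have e2 : e * e = 1 by rewrite -expr2 sqrr_sign.
have e1 : `|e| = 1 by rewrite normr_sign.
set y := cheb_deriv n l t => He.
have C2n : 2 * C <= n%:R.
  have : C <= k%:R by rewrite (le_trans (ltW (truncnS_gt _))) ?ler_nat.
  have : 2 * k%:R <= n%:R :> R by rewrite -natrM ler_nat /n /freq; lia.
  by lra.
have np : 0 < n%:R ^+ l :> R by rewrite exprn_gt0.
have {He} d : `|sin t ^+ l * y - n%:R ^+ l * e| <= n%:R ^+ l / 2.
  rewrite -(ler_pM2l n0) (le_trans He) //.
  by rewrite mulrCA [leRHS]mulrC ler_pM2r // mulrC; lra.
have sy : n%:R ^+ l / 2 <= sin t ^+ l * (e * y).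
  have : n%:R ^+ l - e * (sin t ^+ l * y) <= n%:R ^+ l / 2.
    apply: le_trans d; rewrite -(mul1r `|_|) -e1 -normrM mulrBr.
    by rewrite [e * (_ * e)]mulrCA e2 mulr1 distrC ler_norm.
  by rewrite mulrCA; lra.
have sl : 0 < sin t ^+ l by rewrite exprn_gt0.
have ey0 : 0 < e * y.
  by rewrite -(pmulr_rgt0 _ sl); apply: lt_le_trans sy; rewrite divr_gt0.
have ey : n%:R ^+ l / 2 <= e * y.
  apply: le_trans sy _; apply: ler_piMl; first exact: ltW.
  by apply: exprn_ile1; [exact: ltW | exact: sin_le1].
have /andP[v0 vn] : 0 < cheb_deriv n l (0 : R) <= n%:R ^+ (2 * l).
  by apply: cheb_deriv_at0; rewrite /n /freq; lia.
rewrite /gegenbauer mulrA ler_pdivlMr //; apply: le_trans ey.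
rewrite mulrAC ler_pM2r ?invr_gt0 // mulrC ler_pdivrMr //.
by rewrite -exprD addnn -mul2n.
Qed.
End Nodes.

(** * Finite differences and the gliding hump *)

Section FiniteDifferences.
Variable R : realType.
Implicit Types (f g : R -> R) (h x : R).

Fixpoint fdiff m h f x : R :=
  if m is m'.+1 then fdiff m' h (fun y => f (y + h) - f y) x else f x.

Lemma eq_fdiff m h f g x : f =1 g -> fdiff m h f x = fdiff m h g x.
Proof.
elim: m f g => [|m IHm] f g fg /=; first exact: fg.
by apply: IHm => y; rewrite !fg.
Qed.

Lemma fdiffD m h f g x :
  fdiff m h (fun y => f y + g y) x = fdiff m h f x + fdiff m h g x.
Proof.
elim: m f g => [|m IHm] f g //=; rewrite -IHm; apply: eq_fdiff => y; ring.
Qed.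

Lemma fdiffZ m h a f x : fdiff m h (fun y => a * f y) x = a * fdiff m h f x.
Proof.
elim: m f => [|m IHm] f //=; rewrite -IHm; apply: eq_fdiff => y; ring.
Qed.

Lemma fdiff_bounded m h f x b : (forall y, `|f y| <= b) ->
  `|fdiff m h f x| <= 2 ^+ m * b.
Proof.
elim: m f b => [|m IHm] f b fb /=; first by rewrite mul1r.
rewrite exprSr -mulrA; apply: IHm => y.
by rewrite (le_trans (ler_normB _ _)) // mulr_natl mulr2n lerD.
Qed.

(** With alternating signs all the terms of the difference add up. *)
Lemma fdiff_alternating m h f x d e : 0 <= d -> `|e| = 1 ->
  (forall i, (i <= m)%N -> d <= e * (-1) ^+ i * f (x + i%:R * h)) ->
  d <= `|fdiff m h f x|.
Proof.
move=> d0; elim: m e f => [|m IHm] e f e1 fd /=.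
  have := fd 0%N (leqnn _); rewrite mul0r addr0 mulr1 => /le_trans; apply.
  by rewrite (le_trans (ler_norm _)) // normrM e1 mul1r.
apply: (IHm (- e)); rewrite ?normrN // => i le_im.
rewrite (_ : x + i%:R * h + h = x + i.+1%:R * h); last by rewrite -natr1; ring.
have := fd i.+1 le_im; have := fd i (leqW le_im); rewrite exprS.
move: (f _) (f _) => u v; set s := (-1) ^+ i; lra.
Qed.

(** By induction on m: the mean value theorem, applied to the last function of
    the chain, bounds the increments with step h, and these again form a chain
    of derivatives, shorter by one. *)
Lemma fdiff_smooth m (F : nat -> R -> R) (a b M h x : R) : 0 <= h ->
  (forall j (y : R), (j < m)%N -> a <= y <= b -> is_derive y 1 (F j) (F j.+1 y)) ->
  (forall y, a <= y <= b -> `|F m y| <= M) ->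
  a <= x -> x + m%:R * h <= b ->
  `|fdiff m h (F 0%N) x| <= M * h ^+ m.
Proof.
move=> h0; elim: m F b M => [|m IHm] F b M dF FM ax xb /=.
  by rewrite mulr1 FM // ax /=; rewrite mul0r addr0 in xb.
rewrite exprS mulrA; apply: (IHm (fun j y => F j (y + h) - F j y) (b - h)) => //.
- move=> j y ltjm /andP[ay yb].
  have D1 : is_derive (y + h) 1 (F j) (F j.+1 (y + h)).
    by apply: dF; [exact: ltnW | lra].
  have D2 : is_derive y 1 (F j) (F j.+1 y).
    by apply: dF; [exact: ltnW | lra].
  apply: is_deriveB.
  have := @is_derive1_comp R (F j) (shift h) y (F j.+1 (y + h)) 1.
  by rewrite mulr1 => /(_ D1); apply; exact: is_derive_shift.
- move=> y /andP[ay yb].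
  have dFm z : z \in `[y, y + h] -> is_derive z 1 (F m) (F m.+1 z).
    by rewrite in_itv /= => /andP[yz zh]; apply: dF => //; lra.
  have yyh : y <= y + h by rewrite lerDl.
  have cFm : {within `[y, y + h], continuous (F m)}.
    by apply: derivable_within_continuous => z /dFm [].
  have dFm' z : z \in `]y, y + h[ -> is_derive z 1 (F m) (F m.+1 z).
    by move=> zI; apply: dFm; apply: subset_itv_oo_cc.
  have [c] := MVT_segment yyh dFm' cFm.
  rewrite in_itv /= => /andP[yc ch] ->.
  rewrite addrAC subrr add0r normrM (ger0_norm h0) ler_wpM2r // FM //; lra.
- by rewrite -natr1 mulrDl mul1r in xb; lra.
Qed.
End FiniteDifferences.

Section GlidingHump.
Variable R : realType.
Variables (m : nat) (q : nat -> R -> R) (h x : nat -> R).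
Hypothesis h_gt0 : forall k, 0 < h k.
Hypothesis q_le1 : forall k y, `|q k y| <= 1.
Hypothesis q_smooth : forall j, exists C, forall k,
  `|fdiff m (h k) (q j) (x k)| <= C * h k ^+ m.
Hypothesis q_rough : forall A, exists k, A * h k ^+ m <= `|fdiff m (h k) (q k) (x k)|.

(** The functions S_k + b_k decrease, the functions S_k - b_k increase, and each
    of the latter lies below each of the former; the infimum of the former is
    the limit. *)
Lemma dominated_limit (S : nat -> R -> R) (b : nat -> R) :
  (forall k y, `|S k.+1 y - S k y| <= b k - b k.+1) ->
  (forall k, 0 <= b k) ->
  exists psi : R -> R, forall k y, `|psi y - S k y| <= b k.
Proof.
move=> Sb b0.
have Sd n k y : `|S (n + k)%N y - S k y| <= b k - b (n + k)%N.
  elim: n => [|n IHn]; first by rewrite !subrr normr0.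
  have -> : S (n.+1 + k)%N y - S k y =
    (S (n + k).+1 y - S (n + k)%N y) + (S (n + k)%N y - S k y) by ring.
  rewrite (le_trans (ler_normD _ _)) //.
  by have := Sb (n + k)%N y; rewrite addSn; lra.
(* Sandwich: no lower function exceeds an upper one. *)
have cmp k n y : S k y - b k <= S n y + b n.
  have [le_kn|/ltnW le_nk] := leqP k n.
    by have := Sd (n - k)%N k y; rewrite subnK // ler_norml; have := b0 n; lra.
  by have := Sd (k - n)%N n y; rewrite subnK // ler_norml; have := b0 k; lra.
exists (fun y => inf (range (fun n => S n y + b n))) => k y.
set A := (X in inf X).
have A0 : A !=set0 by exists (S 0%N y + b 0%N); exists 0%N.
have lbA : lbound A (S k y - b k) by move=> _ [n _ <-]; exact: cmp.
rewrite ler_norml; apply/andP; split.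
  have : S k y - b k <= inf A by apply: lb_le_inf.
  by lra.
have : inf A <= S k y + b k.
  by apply: ge_inf; [exists (S k y - b k) | exists k].
by lra.
Qed.

(** The state of the recursion consists of a bound b_i for the sum of the
    remaining coefficients and of a constant M_i such that the differences of
    the partial sum are at most M_i h^m. Half of b_i is spent on the next
    coefficient a_i; its index is chosen by roughness, with a constant that
    beats M_i, the tail and i together; then b_(i+1) is taken below h^m. *)
Lemma gliding_hump : exists (a : nat -> R) (nu : nat -> nat) (psi : R -> R),
  [/\ forall i, 0 < a i,
      forall i y, `|psi y - \sum_(j < i) a j * q (nu j) y| <= 2 ^- i &
      forall i, i%:R * h (nu i) ^+ m <= `|fdiff m (h (nu i)) psi (x (nu i))|].
Proof.
have [C HC] := choice q_smooth; have [K HK] := choice q_rough.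
pose pick i (s : R * R) := K ((i%:R + s.2 + 2 ^+ m) / (s.1 / 2)).
pose step i (s : R * R) :=
  (Num.min (s.1 / 2) (h (pick i s) ^+ m), s.2 + s.1 / 2 * C (pick i s)).
pose st := fix st i := if i is i'.+1 then step i' (st i') else (1, 0).
pose b i := (st i).1; pose a i := b i / 2; pose nu i := pick i (st i).
pose S i y := \sum_(j < i) a j * q (nu j) y.
have b_gt0 i : 0 < b i.
  by elim: i => [|i IHi] //=; rewrite /b /= lt_min divr_gt0 ?exprn_gt0.
have bS i : b i.+1 <= b i / 2 by rewrite /b /= ge_min lexx.
have bh i : b i.+1 <= h (nu i) ^+ m by rewrite /b /= ge_min lexx orbT.
have b2 i : b i <= 2 ^- i.
  elim: i => [|i IHi]; first by rewrite expr0 invr1.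
  rewrite (le_trans (bS i)) // exprS invfM mulrC ler_pM2l ?invr_gt0 //.
have MC i : (st i).2 = \sum_(j < i) a j * C (nu j).
  elim: i => [|i IHi]; first by rewrite big_ord0.
  by rewrite big_ord_recr /= -IHi.
have a_gt0 i : 0 < a i by rewrite divr_gt0.
have SS i y : S i.+1 y - S i y = a i * q (nu i) y.
  by rewrite /S big_ord_recr /= addrAC subrr add0r.
have [|i|psi Hpsi] := @dominated_limit S b.
- move=> i y; rewrite SS normrM (gtr0_norm (a_gt0 i)).
  apply: (@le_trans _ _ (a i)); last by have := bS i; rewrite /a; lra.
  by apply: ler_piMr => //; exact: ltW.
- exact: ltW.
exists a, nu, psi; split=> // [i y|i]; first exact: le_trans (Hpsi i y) (b2 i).
set k := nu i; set H := h k ^+ m.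
have H0 : 0 < H by rewrite exprn_gt0.
pose D f := fdiff m (h k) f (x k).
have D_sum n : `|D (S n)| <= (st n).2 * H.
  elim: n => [|n IHn].
    rewrite mul0r -[leRHS](mulr0 (2 ^+ m)); apply: fdiff_bounded => y.
    by rewrite /S big_ord0 normr0.
  rewrite /D (@eq_fdiff _ _ _ _ (fun y => S n y + a n * q (nu n) y)); last first.
    by move=> y; rewrite -SS; ring.
  rewrite fdiffD fdiffZ (le_trans (ler_normD _ _)) // mulrDl lerD //.
  by rewrite normrM (gtr0_norm (a_gt0 n)) -mulrA ler_wpM2l ?HC ?ltW.
have D_hump : (i%:R + (st i).2 + 2 ^+ m) * H <= `|D (fun y => a i * q k y)|.
  rewrite /D fdiffZ normrM (gtr0_norm (a_gt0 i)) [leRHS]mulrC -ler_pdivrMr //.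
  rewrite mulrAC; exact: HK.
have D_tail : `|D (fun y => psi y - S i.+1 y)| <= 2 ^+ m * H.
  by apply: fdiff_bounded => y; apply: le_trans (Hpsi _ _) (bh i).
have -> : fdiff m (h k) psi (x k) =
   D (S i) + D (fun y => a i * q k y) + D (fun y => psi y - S i.+1 y).
  rewrite /D -!fdiffD; apply: eq_fdiff => y; rewrite -SS; ring.
move: (D_sum i) D_hump D_tail; rewrite !mulrDl.
set u := D _; set v := D _; set w := D _ => hu hv hw.
have : `|v| <= `|u + v + w| + `|u| + `|w|.
  rewrite {1}(_ : v = (u + v + w) - u - w); last by ring.
  by rewrite (le_trans (ler_normB _ _)) // lerD2r ler_normB.
lra.
Qed.
End GlidingHump.

(** * The Gegenbauer polynomials as functions of the angle *)

Section TrigPoly.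
Variable R : realType.
Implicit Types (p q : {poly R}) (t : R).

(** Functions p(cos t) + sin t q(cos t) are closed under differentiation, so
    all the derivatives of p(cos t) are bounded. *)
Definition trig_poly (pq : {poly R} * {poly R}) t : R :=
  pq.1.[cos t] + sin t * pq.2.[cos t].

Definition trig_deriv (pq : {poly R} * {poly R}) : {poly R} * {poly R} :=
  ('X * pq.2 - (1 - 'X ^+ 2) * pq.2^`(), - pq.1^`()).

Lemma is_derive_horner_cos p t :
  is_derive t 1 (fun s => p.[cos s]) (- sin t * p^`().[cos t]).
Proof.
rewrite mulrC; exact: (@is_derive1_comp R (horner p) cos t).
Qed.

Lemma is_derive_trig_poly pq t :
  is_derive t 1 (trig_poly pq) (trig_poly (trig_deriv pq) t).
Proof.
case: pq => p q; rewrite /trig_poly /trig_deriv /=.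
have Dp := is_derive_horner_cos p t; have Dq := is_derive_horner_cos q t.
apply: (is_derive_eq (is_deriveD Dp (is_deriveM (is_derive_sin t) Dq))).
rewrite -polyC1 !hornerE -sin2cos2 /GRing.scale /=; ring.
Qed.

Lemma horner_cos_bounded p : exists2 B, 0 <= B & forall t, `|p.[cos t]| <= B.
Proof.
exists (\sum_(i < size p) `|p`_i|) => [|t]; first exact: sumr_ge0.
rewrite horner_coef (le_trans (ler_norm_sum _ _ _)) // ler_sum // => i _.
rewrite normrM normrX ler_piMr // exprn_ile1 //.
by rewrite ler_norml cos_geN1 cos_le1.
Qed.

Lemma trig_poly_bounded pq : exists B, forall t, `|trig_poly pq t| <= B.
Proof.
have [B B0 HB] := horner_cos_bounded pq.1; have [C C0 HC] := horner_cos_bounded pq.2.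
exists (B + C) => t; rewrite (le_trans (ler_normD _ _)) // lerD // normrM.
rewrite (le_trans _ (HC t)) // ler_piMl //.
by rewrite ler_norml sin_geN1 sin_le1.
Qed.

Lemma fdiff_horner_cos m p : exists C, forall h x, 0 <= h ->
  `|fdiff m h (fun t => p.[cos t]) x| <= C * h ^+ m.
Proof.
have [C HC] := trig_poly_bounded (iter m trig_deriv (p, 0)).
exists C => h x h0.
rewrite (@eq_fdiff _ _ _ _ (trig_poly (p, 0))); last first.
  by move=> t; rewrite /trig_poly /= horner0 mulr0 addr0.
apply: (@fdiff_smooth _ m (fun j => trig_poly (iter j trig_deriv (p, 0)))
  x (x + m%:R * h)) => //.
by move=> j y _ _; exact: is_derive_trig_poly.
Qed.
End TrigPoly.

Section Gegen.
Variable R : realType.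
Implicit Types t : R.

Definition gegenbauer_poly l n : {poly R} :=
  (cheb_deriv n l (0 : R))^-1 *: (chebT R n)^`(l).

Lemma gegenbauerE l n t : gegenbauer l n t = (gegenbauer_poly l n).[cos t].
Proof. by rewrite /gegenbauer_poly hornerZ mulrC. Qed.

Lemma gegenbauer0 l n : (l < n)%N -> gegenbauer l n (0 : R) = 1.
Proof. by move=> /(cheb_deriv_at0 R)/andP[y0 _]; rewrite /gegenbauer divff // gt_eqF. Qed.

Lemma continuous_gegen l n : continuous (gegenbauer l n : R -> R).
Proof.
rewrite (_ : gegenbauer l n = fun t => (gegenbauer_poly l n).[cos t]); last first.
  by apply/funext => t; rewrite gegenbauerE.
move=> t; apply: (@continuous_comp _ _ _ cos (horner (gegenbauer_poly l n))).
  exact: continuous_cos.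
exact: continuous_horner.
Qed.

Lemma gegenbauer_poly_pd l n : (l < n)%N -> forall k (u : 'I_k -> 'I_(2 * l).+2 -> R) c,
  (forall i, Fischer.dot (u i) (u i) = 1) ->
  0 <= \sum_(i < k) \sum_(j < k) c i * c j * (gegenbauer_poly l n).[Fischer.dot (u i) (u j)].
Proof.
move=> ltln k u c u1; have /andP[y0 _] := cheb_deriv_at0 R ltln.
have E : (n - l + l = n)%N by rewrite subnK // ltnW.
have := Fischer.zonal_pd (gegenbauer_chebT R l (n - l)) (gegenbauer_lead R l (n - l)) c u1.
rewrite E => H; under eq_bigr => i _.
  under eq_bigr => j _ do rewrite hornerZ mulrCA.
  by rewrite -mulr_sumr; over.
by rewrite -mulr_sumr mulr_ge0 // invr_ge0 ltW.
Qed.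

(** Positive definiteness at two unit vectors whose inner product is cos t, with
    coefficients 1 and e = 1 or - 1, reads 0 <= 2 (1 + e Q(t)). *)
Lemma gegenbauer_le1 l n t : (l < n)%N -> `|gegenbauer l n t| <= 1.
Proof.
move=> ltln.
pose u (i : 'I_2) : 'I_(2 * l).+2 -> R := fun k =>
  if i == 0 then (k == 0)%:R else cos t *+ (k == 0) + sin t *+ (k == 1).
have dotE (v w : 'I_(2 * l).+2 -> R) : Fischer.dot v w =
  v ord0 * w ord0 + v (lift ord0 ord0) * w (lift ord0 ord0) +
  \sum_(k < 2 * l) v (lift ord0 (lift ord0 k)) * w (lift ord0 (lift ord0 k)).
  by rewrite /Fischer.dot !big_ord_recl addrA.
have uu i j : Fischer.dot (u i) (u j) = if i == j then 1 else cos t.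
  rewrite dotE big1 ?addr0 => [|k _].
    rewrite /u; case: i => [[|[|//]] ?]; case: j => [[|[|//]] ?] //=;
    rewrite ?mulr0n ?mulr1n ?addr0 ?add0r ?mul0r ?mulr0 ?addr0 ?mul1r ?mulr1 //.
    by rewrite -!expr2 cos2Dsin2.
  by rewrite /u; case: i => [[|[|//]] ?]; rewrite /= ?mulr0n ?addr0 ?mul0r.
have key (e : R) : e ^+ 2 = 1 -> 0 <= 1 + e * gegenbauer l n t.
  move=> e2; have u1 i : Fischer.dot (u i) (u i) = 1 by rewrite uu eqxx.
  have := gegenbauer_poly_pd ltln (fun i => if i == 0 then 1 else e) u1.
  have g1 : (gegenbauer_poly l n).[1] = 1 by have := gegenbauer0 ltln; rewrite gegenbauerE cos0.
  rewrite !big_ord_recl !big_ord0 /= !uu /= g1 -!gegenbauerE !addr0.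
  rewrite !mulr1 !mul1r -expr2 e2 => H; lra.
have := key 1 (expr1n _ _); have := key (-1) (sqrr_sign _ 1).
by rewrite ler_norml; lra.
Qed.
End Gegen.

(** * Positive definite functions on the sphere *)

Section Approximation.
Variable R : realType.
Implicit Types (psi : R -> R) (S : nat -> R -> R).

Lemma half_pow_small (e : R) : 0 < e -> exists i, 2 ^- i < e.
Proof.
move=> e0; exists (Num.truncn e^-1).+1.
rewrite -[ltRHS]invrK ltf_pV2 ?posrE ?invr_gt0 ?exprn_gt0 //.
rewrite (lt_trans (truncnS_gt _)) // -natrX ltr_nat.
exact: ltn_expl.
Qed.

Lemma continuous_approx psi S : (forall i, continuous (S i)) ->
  (forall i y, `|psi y - S i y| <= 2 ^- i) -> continuous psi.
Proof.
move=> cS psiS y; apply/cvgrPdist_lt => e e0.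
have [i ie] : exists i, 2 ^- i < e / 3 by apply: half_pow_small; rewrite divr_gt0.
have /cvgrPdist_lt/(_ (e / 3)) := cS i y; rewrite divr_gt0 // => /(_ isT).
apply: filterS => z Hz.
rewrite (_ : psi y - psi z =
  (psi y - S i y) + (S i y - S i z) - (psi z - S i z)); last by ring.
have h1 := psiS i y; have h2 := psiS i z.
rewrite (le_lt_trans (ler_normB _ _)) //.
have := ler_normD (psi y - S i y) (S i y - S i z); move: Hz; lra.
Qed.

(** A negative value of the quadratic form would remain negative for a
    sufficiently close approximation. *)
Lemma positive_definite_approx (T : Type) (A : set T) (d : T -> T -> R) psi S :
  (forall i, positive_definite_on A (fun u v => S i (d u v))) ->
  (forall i y, `|psi y - S i y| <= 2 ^- i) ->
  positive_definite_on A (fun u v => psi (d u v)).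
Proof.
move=> pdS psiS n u c Au; rewrite leNgt; apply/negP.
set Q := \sum_i _ => Q0.
(* The summand 1 only makes the bound positive. *)
pose B := 1 + \sum_(i < n) \sum_(j < n) `|c i * c j|.
have B0 : 0 < B.
  by rewrite ltr_pwDl // sumr_ge0 // => i _; rewrite sumr_ge0.
have [k kB] : exists k, 2 ^- k < - Q / B.
  by apply: half_pow_small; rewrite divr_gt0 // oppr_gt0.
have := pdS k n u c Au; set Qk := \sum_i _ => Qk0.
have : Qk - Q <= 2 ^- k * B.
  rewrite /B mulrDr mulr1 mulr_sumr -sumrB ler_wpDl ?invr_ge0 ?exprn_ge0 //.
  apply: ler_sum => i _; rewrite mulr_sumr -sumrB; apply: ler_sum => j _.
  rewrite -mulrBr (le_trans (ler_norm _)) // normrM mulrC ler_wpM2r //.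
  by rewrite distrC.
by rewrite ltr_pdivlMr // in kB; lra.
Qed.

Lemma positive_definite_onZ (T : Type) (A : set T) (a : R) (f : T -> T -> R) :
  0 <= a -> positive_definite_on A f ->
  positive_definite_on A (fun u v => a * f u v).
Proof.
move=> a0 pdf n u c Au; have := pdf n u c Au.
move=> /(mulr_ge0 a0); rewrite mulr_sumr; congr (0 <= _).
apply: eq_bigr => i _; rewrite mulr_sumr; apply: eq_bigr => j _; ring.
Qed.

Lemma positive_definite_on_sum (T : Type) (A : set T) k (f : 'I_k -> T -> T -> R) :
  (forall s, positive_definite_on A (f s)) ->
  positive_definite_on A (fun u v => \sum_(s < k) f s u v).
Proof.
move=> pdf n u c Au.
have : 0 <= \sum_(s < k) \sum_(i < n) \sum_(j < n) c i * c j * f s (u i) (u j).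
  by apply: sumr_ge0 => s _; exact: pdf.
rewrite exchange_big; congr (0 <= _).
apply: eq_bigr => i _; rewrite exchange_big; apply: eq_bigr => j _.
by rewrite mulr_sumr.
Qed.
End Approximation.

Section Sphere.
Variable R : realType.

Lemma sphere_inner d (u : 'rV[R]_d.+1) : sphere u -> inner u u = 1.
Proof.
rewrite /sphere /= /enorm => u1.
have u0 : 0 <= inner u u by apply: sumr_ge0 => i _; rewrite -expr2 sqr_ge0.
by rewrite -(sqr_sqrtr u0) u1 expr1n.
Qed.

(** |u + v|^2 and |u - v|^2 are nonnegative. *)
Lemma inner_le1 d (u v : 'rV[R]_d.+1) : sphere u -> sphere v ->
  -1 <= inner u v <= 1.
Proof.
move=> /sphere_inner u1 /sphere_inner v1.
have key (e : R) : e ^+ 2 = 1 -> 0 <= 2 + e * (2 * inner u v).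
  move=> e2; rewrite (_ : 2 + _ = \sum_i (u 0 i + e * v 0 i) ^+ 2).
    by apply: sumr_ge0 => i _; rewrite sqr_ge0.
  rewrite (_ : 2 + _ = inner u u + e * (2 * inner u v) + e ^+ 2 * inner v v).
    rewrite /inner !mulr_sumr -!big_split; apply: eq_bigr => i _ /=; ring.
  by rewrite u1 v1 e2; ring.
have := key 1 (expr1n _ _); have := key (-1) (sqrr_sign _ 1); lra.
Qed.

Lemma gegenbauer_positive_definite l n : (l < n)%N ->
  positive_definite_on (@sphere R (2 * l).+1)
    (fun u v => gegenbauer l n (geodesic_dist u v)).
Proof.
move=> ltln k u c u1.
have := gegenbauer_poly_pd ltln (u := fun i j => u i 0 j) c
  (fun i => sphere_inner (u1 i)).
congr (0 <= _); apply: eq_bigr => i _; apply: eq_bigr => j _.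
by rewrite gegenbauerE acosK // in_itv /= inner_le1.
Qed.
End Sphere.

(** * A rough positive definite function *)

Section Final.
Variable R : realType.

Lemma fdiff_continuous_derivative m (f : R -> R) (a b : R) :
  (forall j y, (j < m)%N -> a <= y <= b -> derivable (derive1n j f) y 1) ->
  (forall y, a <= y <= b -> {for y, continuous (derive1n m f)}) ->
  exists M, forall h x, 0 <= h -> a <= x -> x + m%:R * h <= b ->
    `|fdiff m h f x| <= M * h ^+ m.
Proof.
move=> df cf.
have cw : {within `[a, b], continuous (derive1n m f)}.
  apply: continuous_in_subspaceT => y; rewrite inE /= in_itv /=; exact: cf.
have [M [_ HM]] := compact_bounded (continuous_compact cw (@segment_compact R a b)).
exists (M + 1) => h x h0 ax xb.
apply: (@fdiff_smooth _ m (fun j => derive1n j f) a b) => //.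
  move=> j y ltjm yab; rewrite derive1nS derive1E.
  by apply: DeriveDef => //; exact: df.
move=> y yab; apply: HM; first by rewrite ltrDl.
by exists y => //; rewrite /= in_itv.
Qed.

(** The differences have size at least freq^(-l) / 2, which exceeds
    mesh^(l + 1) by the factor freq / (2 pi^(l + 1)). *)
Lemma gegenbauer_rough l (A : R) : exists k, A * mesh R l k ^+ l.+1 <=
  `|fdiff l.+1 (mesh R l k) (gegenbauer l (freq l k)) (start R l k)|.
Proof.
have [K HK] := gegenbauer_node R l.
pose k := maxn K (Num.truncn (2 * A * pi ^+ l.+1)).+1; exists k.
have n0 := freq_gt0 R l k.
apply: (@le_trans _ _ ((freq l k)%:R ^- l / 2)).
  have -> : A * mesh R l k ^+ l.+1 =
      (freq l k)%:R ^- l * (A * pi ^+ l.+1 / (freq l k)%:R).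
    by rewrite /mesh expr_div_n [_%:R ^+ l.+1]exprS invfM; ring.
  rewrite ler_pM2l ?invr_gt0 ?exprn_gt0 // ler_pdivrMr //.
  have : 2 * A * pi ^+ l.+1 <= k%:R.
    by rewrite (le_trans (ltW (truncnS_gt _))) // ler_nat leq_maxr.
  have : k%:R <= (freq l k)%:R :> R by rewrite ler_nat /freq; lia.
  lra.
apply: (@fdiff_alternating _ _ _ _ _ _ ((-1) ^+ (k + 3 * l + 2))).
- by rewrite divr_ge0 // invr_ge0 exprn_ge0.
- by rewrite normr_sign.
- by move=> i le_il; rewrite -exprD; apply: HK; rewrite // leq_maxl.
Qed.
End Final.

Unset Implicit Arguments.

Theorem mainTheorem3 (R : realType) (d : nat) (d_ge1 : (1 <= d)%N)
    (d_odd : odd d) :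
  exists psi : R -> R,
    Psi d psi /\
    ~ has_continuous_derivative_on `]0, pi[ ((d - 1) %/ 2 + 1)%N psi.
Proof.
have [l ->] : exists l, d = (2 * l).+1.
  by exists d./2; rewrite -[LHS]odd_double_half d_odd -mul2n.
have -> : (((2 * l).+1 - 1) %/ 2 + 1)%N = l.+1 by lia.
have ltlf k : (l < freq l k)%N by rewrite /freq; lia.
have [||||a [nu [f [a0 fS fD]]]] := @gliding_hump R l.+1
  (fun k => gegenbauer l (freq l k)) (mesh R l) (start R l).
- exact: mesh_gt0.
- by move=> k y; exact: gegenbauer_le1.
- move=> j; have [C HC] := fdiff_horner_cos l.+1 (gegenbauer_poly R l (freq l j)).
  exists C => k; rewrite (@eq_fdiff _ _ _ _ _ _ (gegenbauerE _ _)).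
  by apply: HC; rewrite ltW ?mesh_gt0.
- exact: gegenbauer_rough.
have f0 : 0 < f 0.
  have [i ia] := half_pow_small (a0 0%N).
  have := fS i.+1 0; rewrite big_ord_recl /= gegenbauer0 // mulr1.
  have : 0 <= \sum_(j < i) a (bump 0 j) * gegenbauer l (freq l (nu (bump 0 j))) (0 : R).
    by apply: sumr_ge0 => j _; rewrite gegenbauer0 // mulr1 ltW.
  have : 2 ^- i.+1 <= 2 ^- i :> R.
    by rewrite exprS invfM ler_piMl ?invr_ge0 ?exprn_ge0 //; lra.
  by rewrite ler_norml; lra.
exists (fun t => (f 0)^-1 * f t); split.
  split.
  - apply: continuous_subspaceT => t; apply: cvgMr.
    apply: continuous_approx fS _ => i.
    apply: continuous_big => [|s _]; first exact: add_continuous.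
    by move=> y; apply: cvgMr; exact: continuous_gegen.
  - by rewrite mulVf ?gt_eqF.
  - apply: positive_definite_onZ; first by rewrite invr_ge0 ltW.
    apply: positive_definite_approx fS => i.
    apply: positive_definite_on_sum => s; apply: positive_definite_onZ.
      exact: ltW.
    exact: gegenbauer_positive_definite.
move=> [df cf].
have p0 := pi_gt0 R.
have Ipi (y : R) : pi / 2 <= y <= pi * (3 / 4) -> `]0, pi[%classic y.
  by rewrite /= in_itv /=; lra.
have [M HM] := fdiff_continuous_derivative
  (fun j y lt_j yI => df j lt_j y (Ipi y yI)) (fun y yI => cf y (Ipi y yI)).
(* At this index the lower bound i h^(l+1) of the hump for f beats the upper
   bound f 0 * M h^(l+1) of a smooth function. *)
pose i := (Num.truncn (f 0 * M)).+1; set k := nu i.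
have /andP[xa _] := node_range R k (leq0n l.+1).
have /andP[_ xb] := node_range R k (leqnn l.+1).
rewrite mul0r addr0 in xa.
have := HM (mesh R l k) _ (ltW (mesh_gt0 R l k)) xa xb.
rewrite fdiffZ normrM gtr0_norm ?invr_gt0 // -ler_pdivlMl ?invr_gt0 // invrK.
move=> /(le_trans (fD i)); rewrite mulrA ler_pM2r ?exprn_gt0 ?mesh_gt0 //.
by rewrite leNgt truncnS_gt.
Qed.
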